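(* Let $\kappa$ be a regular uncountable cardinal and $\lambda>\kappa$ a cardinal. Suppose that (a) $\kappa$ is a limit cardinal such that $2^{<\kappa}=\kappa$, and (b) either $\lambda>\overline{\mathfrak d}_\kappa$, or $\overline{\mathfrak d}_\kappa\in\mathcal K(\kappa,\lambda)$. Then it is not the case that $I_{\kappa,\lambda}^+\xrightarrow[\kappa]{\kappa}[I_{\kappa,\lambda}^+]^2_\kappa$.
   Context: For a cardinal $\mu$ and a set $A$, $P_\mu(A)=\{a\subseteq A:|a|<\mu\}$. $I_{\kappa,\lambda}$ is the set of all $A\subseteq P_\kappa(\lambda)$ such that $A\cap\{b\in P_\kappa(\lambda):a\subseteq b\}=\emptyset$ for some $a\in P_\kappa(\lambda)$; $I_{\kappa,\lambda}^+$ is the set of subsets of $P_\kappa(\lambda)$ not in $I_{\kappa,\lambda}$. $\mathcal K(\kappa,\lambda)$ is the set of all cardinals $\sigma\ge\lambda$ for which there is $T\subseteq P_\kappa(\lambda)$ with $|T|=\sigma$ and $|T\cap P(a)|<\kappa$ for every $a\in P_\kappa(\lambda)$. $\overline{\mathfrak d}_\kappa$ is the least cardinality of an $X\subseteq{}^\kappa\kappa$ such that for every $g\in{}^\kappa\kappa$ there is $x\in P_\kappa(X)$ with $g(\alpha)<\bigcup_{f\in x}f(\alpha)$ for all $\alpha<\kappa$. For $A\subseteq P_\kappa(\lambda)$, $[A]^2_{\kappa,\kappa}=\{(\bigcup(a\cap\kappa),\bigcup(b\cap\kappa)):a,b\in A,\ \bigcup(a\cap\kappa)<\bigcup(b\cap\kappa)\}$.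 For a cardinal $\rho\in[2,\kappa]$, $I_{\kappa,\lambda}^+\xrightarrow[\kappa]{\kappa}[I_{\kappa,\lambda}^+]^2_\rho$ means: for every $F:[P_\kappa(\lambda)]^2_{\kappa,\kappa}\to\rho$ and every $A\in I_{\kappa,\lambda}^+$ there is $B\in I_{\kappa,\lambda}^+\cap P(A)$ such that $F''[B]^2_{\kappa,\kappa}\ne\rho$. *)

(* Defs.v *)
From HB Require Import structures.
From mathcomp Require Import all_boot all_order.
From mathcomp Require Import boolp classical_sets functions cardinality.
From mathcomp Require wochoice.

Set Implicit Arguments.
Unset Strict Implicit.
Unset Printing Implicit Defensive.

Import Order.TTheory.
Local Open Scope classical_set_scope.
Local Open Scope card_scope.
Local Open Scope order_scope.

(* A well-ordered type [L] plays the role of an ordinal lambda. An ordinal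
   [x] < lambda is an element [x : L]; as a von Neumann ordinal it is the set
   [seg x] of its predecessors. Cardinalities that need not be below lambda are
   represented by sets (of any type), compared with [#<=], [#=] and [#<].
   [Psmall k X] is P_k(X), [Pkl k] is P_k(lambda), [Ikl k] is I_{k,lambda} and
   [pairs k A] is [A]^2_{k,k}. *)

Definition card_lt T U (A : set T) (B : set U) : bool :=
  (A #<= B) && ~~ (B #<= A).
Notation "A '#<' B" := (card_lt A B)
  (at level 79, format "A  '#<'  B") : card_scope.

Lemma min_card_exists (U : Type) (Phi : set (set U)) : Phi !=set0 ->
  exists D, Phi D /\ forall X, Phi X -> D #<= X.
Proof.
move=> [X0 PhiX0].
pose P (S : set (set U -> U)) :=
  (forall f X, S f -> Phi X -> X (f X)) /\
  (forall f g X, S f -> S g -> Phi X -> f X = g X -> f = g).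
have [S [[SX Sinj] Smax]] : exists S, P S /\ forall B, S `<` B -> ~ P B.
  apply: Zorn_bigcup => F FP Ftot; split=> [f X [S FS Sf]|f g X [S FS Sf] [T FT Tg]].
    by case: (FP _ FS) => + _; apply.
  case: (Ftot _ _ FS FT) => ST; move: Sf Tg => Sf Tg.
    by case: (FP _ FT) => _; apply=> //; apply: ST.
  by case: (FP _ FS) => _; apply=> //; apply: ST.
have [[D PhiD DS]|noD] := pselect (exists2 D, Phi D & D `<=` (fun f => f D) @` S).
  exists D; split=> // X PhiX.
  apply: card_le_trans (subset_card_le DS) _.
  apply: card_le_trans (card_image_le _ _) _.
  have [f] : $|{injfun S >-> X}|.
    apply/injfunPex; exists (fun f : set U -> U => f X) => [f Sf|f g].
      by move: PhiX; apply: SX.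
    by rewrite !inE => Sf Sg; apply: Sinj.
  exact: inj_card_le f.
have new X : exists u : U, Phi X -> X u /\ forall f, S f -> f X <> u.
  have [PhiX|nPhiX] := pselect (Phi X); last first.
    have [[u _]|X00] := pselect (exists u, X0 u); first by exists u.
    by exfalso; apply: noD; exists X0 => // u X0u; case: X00; exists u.
  have [//|nu] := pselect (exists u : U, Phi X -> X u /\ forall f, S f -> f X <> u).
  exfalso; apply: noD; exists X => // u Xu.
  have [//|nim] := pselect (((fun f => f X) @` S) u).
  by exfalso; apply: nu; exists u => _; split=> // f Sf fXu; apply: nim; exists f.
have [h hP] := choice new.
exfalso; have /= := Smax (S `|` [set h]); apply.
  split; first by move=> f; left.
  move=> /(_ h (or_intror erefl)) Sh.
  by case: (hP _ PhiX0) => _ /(_ h Sh).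
split=> [f X [Sf|->] PhiX|f g X [Sf|->] [Sg|->] PhiX //].
- by apply: SX PhiX.
- by case: (hP _ PhiX).
- exact: Sinj.
- by case: (hP _ PhiX) => _ /(_ f Sf) h1 /h1.
- by case: (hP _ PhiX) => _ /(_ g Sg) h1 /esym /h1.
Qed.

Lemma card_lt_set1 T U (u : U) (A : set T) : infinite_set A -> [set u] #< A.
Proof.
move=> Ainf; apply/andP; split; last first.
  by apply/negP => /card_le_finite /(_ (finite_set1 u)).
have [x Ax] := infinite_setN0 Ainf.
have [f] : $|{injfun [set u] >-> A}|.
  by apply/injfunPex; exists (fun=> x) => // y z; rewrite !inE => -> ->.
exact: inj_card_le f.
Qed.

Section Combinatorics.
Context {d : Order.disp_t} {L : orderType d}.
Implicit Types (x y k m r s : L) (A B : set (set L)).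

Definition wellordered : Prop := wochoice.well_order (fun x y : L => x <= y).

Definition seg x : set L := [set y | y < x].

Definition is_cardinal x : Prop := forall y, y < x -> seg y #< seg x.

(* The order type of the whole of [L] is a cardinal. *)
Definition top_is_cardinal : Prop := forall y, seg y #< [set: L].

Definition limit_cardinal k : Prop :=
  is_cardinal k /\
  forall m, is_cardinal m -> m < k -> exists n, is_cardinal n /\ m < n < k.

Definition cofinal_in k (C : set L) : Prop :=
  C `<=` seg k /\ forall x, x < k -> exists2 y, C y & x <= y.

Definition regular_cardinal k : Prop :=
  [/\ is_cardinal k, infinite_set (seg k)
    & forall C, cofinal_in k C -> seg k #<= C].

Definition bounds_pow_below k s : Prop :=
  forall m, is_cardinal m -> m < k -> [set: seg m -> bool] #<= seg s.

(* 2^{<k} = s, where 2^{<k} is the supremum of the cardinals 2^m, m < k. *)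
Definition pow_below_eq k s : Prop :=
  [/\ is_cardinal s, bounds_pow_below k s
    & forall t, is_cardinal t -> bounds_pow_below k t -> s <= t].

Definition Psmall (U : Type) k (X : set U) : set (set U) :=
  [set a | a `<=` X /\ a #< seg k].

Definition Pkl k : set (set L) := Psmall k [set: L].

Definition Ikl k : set (set (set L)) :=
  [set A | A `<=` Pkl k /\
    exists2 a, Pkl k a & A `&` [set b | Pkl k b /\ a `<=` b] = set0].

Definition Ikl_pos k : set (set (set L)) :=
  [set A | A `<=` Pkl k /\ ~ Ikl k A].

(* [calK k S] says that the cardinality of [S] is in K(k,lambda). *)
Definition calK (U : Type) k (S : set U) : Prop :=
  [set: L] #<= S /\
  exists T : set (set L), [/\ T `<=` Pkl k, T #= S
    & forall a, Pkl k a -> T `&` [set t | t `<=` a] #< seg k].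

(* The union of the f(alpha), for f in x, is that of the von Neumann ordinals
   [seg (f alpha)], and being below it means being an element of it. *)
Definition dominating k (X : set (seg k -> seg k)) : Prop :=
  forall g : seg k -> seg k, exists2 x, Psmall k X x &
    forall alpha : seg k,
      (\bigcup_(f in x) seg (\val (f alpha))) (\val (g alpha)).

Definition least_dominating k : set (set (seg k -> seg k)) :=
  [set D | dominating D /\
    forall X : set (seg k -> seg k), dominating X -> D #<= X].

Arguments least_dominating k _ : clear implicits.

(* A set whose cardinality is the cardinal \overline{d}_k; by [dbarP] below the
   default value [setT] plays no role when [k] is regular. *)
Definition dbar k : set (seg k -> seg k) := xget setT (least_dominating k).

Arguments dbar k _ : clear implicits.

(* The union of a set of ordinals, as an element of [L]; by [ounionP] below the
   default value [k] is not used on small subsets of a regular [k]. *)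
Definition ounion k (a : set L) : L :=
  xget k [set e | seg e = \bigcup_(x in a) seg x].

Definition pairs k A : set (L * L) :=
  [set p | exists a b, [/\ A a, A b,
     p = (ounion k (a `&` seg k), ounion k (b `&` seg k)) & p.1 < p.2]].

(* I_{k,lambda}^+ --> [I_{k,lambda}^+]^2_r, for pairs from [.]^2_{k,k};
   the ordinal r is the set [seg r]. *)
Definition square_bracket k r : Prop :=
  forall F : L * L -> L, set_fun (pairs k (Pkl k)) (seg r) F ->
  forall A, Ikl_pos k A ->
  exists B, [/\ Ikl_pos k B, B `<=` A & F @` pairs k B <> seg r].

Lemma wo_min (hwo : wellordered) (C : set L) :
  C !=set0 -> exists2 e, C e & forall y, C y -> e <= y.
Proof.
move=> [x Cx]; have [|e [[eC emin] _]] := hwo (fun z => `[< C z >]).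
  by exists x; apply/asboolP.
exists e; first exact/asboolP.
by move=> y Cy; apply: emin; apply/asboolP.
Qed.

Lemma regular_unbounded k (hreg : regular_cardinal k) (a : set L) :
  a `<=` seg k -> a #< seg k -> exists2 x, x < k & forall y, a y -> y < x.
Proof.
move=> ak /andP[_ /negP nle]; case: hreg => _ _ hcof.
have [//|noub] := pselect (exists2 x, x < k & forall y, a y -> y < x).
exfalso; apply: nle; apply: hcof; split=> // x xk.
have [//|noy] := pselect (exists2 y, a y & x <= y).
exfalso; apply: noub; exists x => // y ay.
by rewrite ltNge; apply/negP => xy; apply: noy; exists y.
Qed.

Lemma ounionP (hwo : wellordered) k (hreg : regular_cardinal k) (a : set L) :
  a `<=` seg k -> a #< seg k ->
  seg (ounion k a) = \bigcup_(x in a) seg x /\ ounion k a < k.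
Proof.
move=> ak ask; have [x xk ax] := regular_unbounded hreg ak ask.
pose U := \bigcup_(x in a) seg x.
have [|e Ue emin] := @wo_min hwo (~` U).
  by exists x => -[y ay]; rewrite /seg/= => /(lt_trans (ax _ ay)); rewrite ltxx.
have segeU : seg e = U.
  apply/seteqP; split=> [z ze|z [y ay zy]].
    have [//|nUz] := pselect (U z).
    by have := emin _ nUz; rewrite leNgt ze.
  rewrite /seg/= ltNge; apply/negP => ez; apply: Ue; exists y => //.
  exact: le_lt_trans ez zy.
have key : seg (ounion k a) = U.
  by apply: (@xgetPex L k [set e | seg e = U]); exists e.
split=> //; rewrite ltNge; apply/negP => kle.
have: U x by rewrite -key; apply: lt_le_trans xk kle.
by move=> [y ay]; rewrite /seg/= => /(lt_trans (ax _ ay)); rewrite ltxx.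
Qed.

Lemma dbarP (hwo : wellordered) k (hreg : regular_cardinal k) :
  least_dominating k (dbar k).
Proof.
suff h : least_dominating k !=set0 by apply: xgetPex.
have [|D [domD Dmin]] := @min_card_exists _ (@dominating k); last by exists D.
have kinf : infinite_set (seg k) by case: hreg.
have next (b : seg k) : exists c : seg k, \val b < \val c.
  have bk : \val b < k by have := valP b; rewrite inE.
  have [||x xk bx] := @regular_unbounded k hreg [set \val b].
  - by move=> _ ->.
  - exact: card_lt_set1.
  have xk' : x \in seg k by rewrite inE.
  by exists (SigSub xk') => /=; apply: bx.
have [s sP] := choice next.
exists setT => g; exists [set s \o g]; last first.
  by move=> alpha; exists (s \o g) => //; exact: sP.
by split=> //; apply: card_lt_set1.
Qed.

End Combinatorics.
Arguments least_dominating {d L} k _.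
Arguments dbar {d L} k _.
Arguments wellordered {d} L.
Arguments top_is_cardinal {d} L.

(* Main.v *)
(* Give each f in a dominating family X of least size a set psi f in P_k(lambda)
   so that a given a in P_k(lambda) contains fewer than k of the psi f; then some
   h_a : k -> k bounds all of these f. Let C_a be the set of closure points of
   h_a, which is unbounded in k because k is regular and uncountable, and let
   p_a(x) be the rank of x when ordinals are compared only if a point of C_a
   separates them. As 2^{<k} = k, an ordinal m < k can code an initial segment of
   C_a, and F(x, m) is the rank of x computed from the set coded by m. Let A
   consist of the sets a U {m}, where m codes a long enough piece of C_a; it is
   cofinal. If B is a cofinal subset of A, then S = {sup (b n k) : b in B} is
   unbounded in k, and its gaps are dominated by h_a for some a U {m} in B. So S
   meets every interval between points of C_a, hence p_a takes all values on S,
   and F takes all values on the pairs from B. *)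

Require Import Defs.
From mathcomp Require Import all_boot all_order.
From mathcomp Require Import boolp classical_sets functions cardinality.

Set Implicit Arguments.
Unset Strict Implicit.
Unset Printing Implicit Defensive.

Import Order.TTheory.
Local Open Scope order_scope.
Local Open Scope classical_set_scope.
Local Open Scope card_scope.

(** * Comparison of cardinalities *)

Lemma card_leI T U (A : set T) (B : set U) (f : T -> U) :
  (forall x, A x -> B (f x)) -> {in A &, injective f} -> A #<= B.
Proof.
move=> fAB finj.
have [g] : $|{injfun A >-> B}| by apply/injfunPex; exists f.
exact: inj_card_le g.
Qed.

Lemma card_leE T U (u : U) (A : set T) (B : set U) : A #<= B ->
  exists2 f : T -> U, forall x, A x -> B (f x) & {in A &, injective f}.
Proof.
move=> /card_leP[f0].
have /injfunPex[f fAB finj] : $|{injfun A >-> B}| by squash (valLR u f0).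
by exists f.
Qed.

(** Disjoint copies of [A] and [B] are placed in one sum type, where [min_card_exists] picks the
    smaller of the two. *)
Lemma card_le_total T U (A : set T) (B : set U) : A #<= B \/ B #<= A.
Proof.
pose A' : set (T + U) := inl @` A; pose B' : set (T + U) := inr @` B.
have AA' : A' #= A by apply: inj_card_eq => x y _ _ [].
have BB' : B' #= B by apply: inj_card_eq => x y _ _ [].
have [|D [DAB Dmin]] := @min_card_exists _ [set A'; B']; first by exists A'; left.
have {Dmin} [DA DB] : D #<= A' /\ D #<= B' by split; apply: Dmin; [left|right].
case: DAB DA DB => -> DA DB; [left|right].
  by rewrite -(card_le_eql AA') -(card_le_eqr BB').
by rewrite -(card_le_eql BB') -(card_le_eqr AA').
Qed.

Lemma card_ltNge T U (A : set T) (B : set U) : (A #< B) = ~~ (B #<= A).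
Proof.
rewrite /card_lt; have [BA|nBA] := boolP (B #<= A); first by rewrite andbF.
by have [AB|BA] := card_le_total A B; [rewrite AB|rewrite BA in nBA].
Qed.

Lemma card_le_lt_trans T U V (B : set U) (A : set T) (C : set V) :
  A #<= B -> B #< C -> A #< C.
Proof.
rewrite !card_ltNge => AB; apply: contra => CA; exact: card_le_trans CA AB.
Qed.

(** * Recursion and rank functions on a well-order *)

Section WellOrder.
Context {d : Order.disp_t} {L : orderType d} (hwo : wellordered L).

Lemma wo_wf : well_founded (fun x y : L => x < y).
Proof.
move=> x; have [//|nAx] := pselect (Acc (fun x y : L => x < y) x).
have [|m nAm mmin] := @wo_min _ _ hwo [set y | ~ Acc (fun x y : L => x < y) y].
  by exists x.
exfalso; apply: nAm; constructor => y ym.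
have [//|nAy] := pselect (Acc (fun x y : L => x < y) y).
by have := mmin _ nAy; rewrite leNgt ym.
Qed.

Definition is_rank (R : L -> L -> Prop) (p : L -> L) :=
  forall x, (forall y, R y x -> p y < p x) /\
            (forall z, (forall y, R y x -> p y < z) -> p x <= z).

(** Recursion along [<]: [p x] is the least strict upper bound of the values at [R]-predecessors.
    Inductively these satisfy [p y <= y < x], so [x] is such a bound and the minimum exists. *)
Lemma rank_exists (R : L -> L -> Prop) :
  (forall y x, R y x -> y < x) -> exists2 p, is_rank R p & forall x, p x <= x.
Proof.
move=> Rlt.
pose ub x (p : forall y, y < x -> L) :=
  [set z | forall y (yx : y < x), R y x -> p y yx < z].
pose G x p := xget x [set z | ub x p z /\ forall z', ub x p z' -> z <= z'].
pose p := Fix wo_wf (fun=> L) G.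
have pE x : p x = G x (fun y _ => p y).
  rewrite {1}/p Fix_eq // => y f g fg.
  by congr G; do 2 apply: functional_extensionality_dep => ?.
have key x : ((forall y, R y x -> p y < p x) /\
              (forall z, (forall y, R y x -> p y < z) -> p x <= z)) /\ p x <= x.
  elim/(well_founded_ind wo_wf) : x => x IH.
  have ubx : ub x (fun y _ => p y) x.
    by move=> y yx _; case: (IH _ yx) => _ /le_lt_trans; apply.
  have [|m um mmin] := @wo_min _ _ hwo (ub x (fun y _ => p y)); first by exists x.
  have [ux xmin] : ub x (fun y _ => p y) (p x) /\
      forall z', ub x (fun y _ => p y) z' -> p x <= z'.
    rewrite pE; apply: (@xgetPex _ x [set z | ub x (fun y _ => p y) z /\
      forall z', ub x (fun y _ => p y) z' -> z <= z']).
    by exists m.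
  split; last exact: xmin.
  split=> [y Ryx|z zub]; first by apply: ux => //; apply: Rlt.
  by apply: xmin => y _; apply: zub.
by exists p => x; case: (key x).
Qed.

(** This lets a rank be computed from a code that is correct only up to [t]. *)
Lemma rank_local (R R' : L -> L -> Prop) p p' t :
  (forall y x, R y x -> y < x) ->
  is_rank R p -> is_rank R' p' ->
  (forall y x, x <= t -> R y x <-> R' y x) ->
  forall x, x <= t -> p x = p' x.
Proof.
move=> Rlt pP p'P RR' x; elim/(well_founded_ind wo_wf) : x => x IH xt.
have E y : R y x -> p y = p' y.
  by move=> /Rlt yx; apply: IH => //; apply: le_trans (ltW yx) xt.
apply/le_anti/andP; split.
  apply: (pP x).2 => y Ryx; rewrite (E _ Ryx); apply: (p'P x).1.
  exact/RR'.
by apply: (p'P x).2 => y /(RR' _ _ xt) Ryx; rewrite -(E _ Ryx); apply: (pP x).1.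
Qed.

Lemma card_exists (i : L) : exists m, [/\ is_cardinal m, m <= i & seg i #<= seg m].
Proof.
have [|m im mmin] := @wo_min _ _ hwo [set m | seg i #<= seg m].
  by exists i; apply: card_lexx.
exists m; split=> //; last exact: mmin (card_lexx _).
move=> y ym; rewrite card_ltNge; apply/negP => my.
by have := mmin y (card_le_trans im my); rewrite leNgt ym.
Qed.

(** * Sets of size less than a regular cardinal *)

Section Regular.
Context (k : L) (hreg : regular_cardinal k).

Lemma seg_small x : x < k -> seg x #< seg k.
Proof. by case: hreg => + _ _; apply. Qed.

Lemma small_bound T (A : set T) (f : T -> L) :
  A #< seg k -> (forall x, A x -> f x < k) ->
  exists2 y, y < k & forall x, A x -> f x < y.
Proof.
move=> As fk.
have [||y yk fy] := @regular_unbounded _ _ k hreg (f @` A).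
- by move=> _ [x Ax <-]; apply: fk.
- by apply: card_le_lt_trans As; apply: card_image_le.
by exists y => // x Ax; apply: fy; exists x.
Qed.

Lemma small_set1 T (x : T) : [set x] #< seg k.
Proof. by apply: card_lt_set1; case: hreg. Qed.

Lemma lt_limit x : x < k -> exists2 y, y < k & x < y.
Proof.
move=> xk; have [|y yk xy] := small_bound (f := id) (small_set1 x); first by move=> _ ->.
by exists y => //; apply: xy.
Qed.

(** If [seg k] injected into the union, each [F i] would catch only a bounded set of indices. By
    regularity one [c < k] exceeds all these bounds, and then the image of [c] lies in no [F i]. *)
Lemma small_bigcup I T (D : set I) (F : I -> set T) :
  D #< seg k -> (forall i, D i -> F i #< seg k) -> \bigcup_(i in D) F i #< seg k.
Proof.
move=> Ds Fs; rewrite card_ltNge; apply/negP => kle.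
have [t _] : (\bigcup_(i in D) F i) !=set0.
  apply/set0P/eqP => U0; move: kle; rewrite U0 card_le0 => /eqP k0.
  by case: hreg => _ + _; rewrite k0; apply; apply: finite_set0.
have [j jU jinj] := card_leE t kle.
have bnd i : exists b, D i -> b < k /\ forall z, z < k -> F i (j z) -> z < b.
  have [Di|] := pselect (D i); last by exists k.
  have [||b bk bP] := @small_bound _ [set z | z < k /\ F i (j z)] id.
  - apply: card_le_lt_trans (Fs _ Di); apply: (@card_leI _ _ _ _ j); first by move=> z [].
    by move=> x y; rewrite !inE => -[xk _] [yk _]; apply: jinj; rewrite inE.
  - by move=> z [].
  by exists b => _; split=> // z zk Fz; apply: bP.
have [b bP] := choice bnd.
have [|c ck cP] := small_bound (f := b) Ds; first by move=> i /bP[].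
have [i Di Fi] := jU _ ck.
by have := lt_trans ((bP i Di).2 _ ck Fi) (cP _ Di); rewrite ltxx.
Qed.

Lemma small_finite T (A : set T) : finite_set A -> A #< seg k.
Proof.
move=> Afin; rewrite card_ltNge; apply/negP => kA.
by case: hreg => _ + _; apply; apply: card_le_finite kA Afin.
Qed.

Lemma small_setU T (A B : set T) : A #< seg k -> B #< seg k -> A `|` B #< seg k.
Proof.
move=> As Bs; have -> : A `|` B = \bigcup_(b in [set: bool]) (if b then A else B).
  apply/seteqP; split=> [x [Ax|Bx]|x [[] _ ?]]; by [exists true|exists false|left|right].
by apply: small_bigcup => [|[] _ //]; apply: small_finite; apply: finite_finset.
Qed.

(** * Coding bounded subsets of k by ordinals below k *)

Lemma small_embedding (T : Type) (R : T -> T -> Prop) (D : set T) :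
  well_founded R -> (forall x y, D x -> D y -> x <> y -> R x y \/ R y x) ->
  (forall x, D x -> [set y | D y /\ R y x] #< seg k) ->
  exists2 f : T -> L, forall x, D x -> f x < k & {in D &, injective f}.
Proof.
move=> wfR Rtot Rsmall.
(* Greedy choice: a value below [k] not yet taken by a predecessor in [D]. The default [k] does not
   occur on [D], where fewer than [k] values are taken. *)
pose G x (p : forall y, R y x -> L) :=
  xget k [set v | v < k /\ forall y (Ryx : R y x), D y -> p y Ryx <> v].
pose f := Fix wfR (fun=> L) G.
have fE x : f x = G x (fun y _ => f y).
  rewrite {1}/f Fix_eq // => y p q pq.
  by congr G; do 2 apply: functional_extensionality_dep => ?.
have fP x : D x -> f x < k /\ forall y, R y x -> D y -> f y <> f x.
  move=> Dx; rewrite fE.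
  apply: (@xgetPex _ k [set v | v < k /\ forall y (Ryx : R y x), D y -> f y <> v]).
  have [//|nov] := pselect
    ([set v | v < k /\ forall y (Ryx : R y x), D y -> f y <> v] !=set0).
  have := Rsmall _ Dx; rewrite card_ltNge => /negP[].
  apply: card_le_trans (card_image_le f _); apply: subset_card_le => v vk.
  have [//|nim] := pselect ((f @` [set y | D y /\ R y x]) v).
  by exfalso; apply: nov; exists v; split=> // y Ryx Dy fyv; apply: nim; exists y.
exists f => [x /fP[]//|x y]; rewrite !inE => Dx Dy fxy.
have [//|xny] := pselect (x = y).
exfalso; have [Rxy|Ryx] := Rtot _ _ Dx Dy xny.
  by case: (fP _ Dy) => _ /(_ _ Rxy Dx).
by case: (fP _ Dx) => _ /(_ _ Ryx Dy); rewrite fxy.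
Qed.

Definition goedel_lt (p q : L * L) : Prop :=
  let M r := Order.max r.1 r.2 in
  M p < M q \/ M p = M q /\ (p.1 < q.1 \/ p.1 = q.1 /\ p.2 < q.2).

Lemma goedel_wf : well_founded goedel_lt.
Proof.
suff h m x y : Order.max x y = m -> Acc goedel_lt (x, y) by move=> [x y]; apply: h.
elim/(well_founded_ind wo_wf) : m x y => m IHm x.
elim/(well_founded_ind wo_wf) : x => x IHx y.
elim/(well_founded_ind wo_wf) : y => y IHy xym.
constructor=> -[a b] [|[]] /=.
  by rewrite xym => abm; apply: IHm abm _ _ _.
by rewrite xym => abm [ax|[ax ay]]; [apply: IHx|rewrite ax in abm *; apply: IHy].
Qed.

(** As [goedel_lt] compares maxima first, the predecessors of a pair lie in a square of side
    [m < k], so there are fewer than [k] of them. *)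
Lemma square_injection : exists2 g : L * L -> L,
  forall p, (seg k `*` seg k) p -> g p < k & {in seg k `*` seg k &, injective g}.
Proof.
apply: (small_embedding goedel_wf) => [[a b] [x y] _ _ ne|[a b] [/= ak bk]].
  rewrite /goedel_lt/=.
  have [h|h|h] := ltgtP (Order.max a b) (Order.max x y); try by [left; left|right; left].
  have [ax|ax|ax] := ltgtP a x; [by left; right; split=> //; left
                                |by right; right; split=> //; left|].
  have [by_|by_|by_] := ltgtP b y; [by left; right; split=> //; right
                                |by right; right; split=> //; right|].
  by case: ne; rewrite ax by_.
have [m mk abm] : exists2 m, m < k & Order.max a b < m.
  by apply: lt_limit; rewrite gt_max; apply/andP.
have sub : [set y | (seg k `*` seg k) y /\ goedel_lt y (a, b)] `<=`
    \bigcup_(x in seg m) (fun y => (x, y)) @` seg m.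
  move=> [x y] [_ lxy].
  have : Order.max x y < m.
    by case: lxy => /= [/lt_trans|[-> _]] //; apply.
  by rewrite gt_max => /andP[xm ym]; exists x => //; exists y.
apply: card_le_lt_trans (subset_card_le sub) _.
apply: small_bigcup => [|x _]; first exact: seg_small.
by apply: card_le_lt_trans (card_image_le _ _) _; apply: seg_small.
Qed.

(** The power bound speaks of cardinals only, so subsets of [seg i] are first moved to the cardinal
    [m] of [i]. *)
Lemma subsets_of_seg i : bounds_pow_below k k -> i < k -> exists s : L -> set L,
  forall Z, Z `<=` seg i -> exists2 j, j < k & s j = Z.
Proof.
move=> hpow ik; have [m [mcard mi im]] := card_exists i.
have [u um uinj] := card_leE k im.
have [c ck cinj] := card_leE k (hpow _ mcard (le_lt_trans mi ik)).
exists (fun j => [set z | z < i /\ exists2 phi, c phi = j &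
  exists2 v : seg m, \val v = u z & phi v]) => Z Zi.
pose phi (v : seg m) := `[< exists2 z, Z z & u z = \val v >].
exists (c phi); first exact: ck.
apply/seteqP; split=> [z [zi [psi /cinj psiE [v vE psiv]]]|z Zz].
  have {}psiE : psi = phi by apply: psiE; rewrite inE.
  move: psiv; rewrite psiE => /asboolP[z' Zz' z'E].
  have -> // : z = z'.
  by apply: uinj; rewrite ?inE; [exact: zi|exact: Zi|rewrite z'E vE].
have zi := Zi _ Zz; split=> //; exists phi => //.
have uzm : u z \in seg m by rewrite inE; exact: um.
by exists (SigSub uzm) => //; apply/asboolP; exists z.
Qed.

(** The code [g (i, j)] says that [Y] meets [seg i] in the [j]-th subset of [seg i]. Every [i] above
    [t] yields a code, and these are distinct, so some code exceeds [x]. *)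
Lemma bounded_subset_codes : bounds_pow_below k k -> exists e : L -> set L,
  forall Y x t, x < k -> t < k ->
  exists b, [/\ b < k, x < b & forall y, y <= t -> (e b y <-> Y y)].
Proof.
move=> hpow; have [g gk ginj] := square_injection.
have ex_s i : exists s : L -> set L,
    i < k -> forall Z, Z `<=` seg i -> exists2 j, j < k & s j = Z.
  have [ik|] := boolP (i < k); last by exists (fun=> set0).
  by have [s sP] := subsets_of_seg hpow ik; exists s.
have [s sP] := choice ex_s.
exists (fun b => [set z | exists i j, [/\ i < k, j < k, g (i, j) = b & s i j z]]).
move=> Y x t xk tk.
have ex_j i : exists j, i < k -> j < k /\ s i j = Y `&` seg i.
  have [ik|] := boolP (i < k); last by exists k.
  by have [|j jk jE] := sP i ik (Y `&` seg i); [move=> ? []|exists j].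
have [j jP] := choice ex_j.
(* Otherwise the interval from [t] to [k] would inject into [seg y] for some [y < k], hence be
   bounded below [k]. *)
have [i [ti ik xg]] : exists i, [/\ t < i, i < k & x < g (i, j i)].
  have [//|noi] := pselect (exists i, [/\ t < i, i < k & x < g (i, j i)]).
  have [y yk xy] := lt_limit xk.
  have small : [set i | t < i /\ i < k] #< seg k.
    apply: card_le_lt_trans (seg_small yk).
    apply: (@card_leI _ _ _ _ (fun i => g (i, j i))) => [i [ti ik]|a b].
      by rewrite /seg/= ltNge; apply/negP => yg; apply: noi; exists i;
        split=> //; apply: lt_le_trans yg.
    rewrite !inE => -[_ ak] [_ bk] /ginj; rewrite !inE => E.
    have [jak _] := jP _ ak; have [jbk _] := jP _ bk.
    by have [] : (a, j a) = (b, j b) by apply: E.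
  have [|z zk zP] := small_bound (f := id) small; first by move=> ? [].
  have mk : Order.max t z < k by rewrite gt_max tk zk.
  have [w wk] := lt_limit mk; rewrite gt_max => /andP[tw zw].
  by have := lt_trans zw (zP w (conj tw wk)); rewrite ltxx.
have [jk sE] := jP _ ik.
exists (g (i, j i)); split=> // [|y yt]; first exact: gk.
split=> [[i' [j' [i'k j'k /ginj]]]|Yy].
  rewrite !inE => /(_ (conj i'k j'k) (conj ik jk)) [-> ->].
  by rewrite sE => -[].
by exists i, (j i); split=> //; rewrite sE; split=> //; apply: le_lt_trans ti.
Qed.

(** * Closure points and the ranks they induce *)

Definition closure_points (h : L -> L) : set L :=
  [set y | y < k /\ forall x, x < y -> h x <= y].

(** The point is the supremum of countably many iterates of [next], which stays below [k] because
    [k] is regular and uncountable. *)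
Lemma closure_points_unbounded (h : L -> L) : ~ countable (seg k) ->
  (forall x, x < k -> h x < k) ->
  forall x, x < k -> exists2 y, closure_points h y & x < y.
Proof.
move=> hunc hk x xk.
have ex_next z : exists z', z < k -> [/\ z' < k, z < z' & forall w, w < z -> h w <= z'].
  have [zk|] := boolP (z < k); last by exists k.
  have [|b bk bP] := small_bound (f := h) (seg_small zk).
    by move=> w wz; apply: hk; apply: lt_trans zk.
  have [|c ck] := @lt_limit (Order.max z b); first by rewrite gt_max zk bk.
  rewrite gt_max => /andP[zc bc]; exists c => _; split=> // w wz.
  exact: ltW (lt_trans (bP w wz) bc).
have [next nextP] := choice ex_next.
pose u n := iter n next x.
have uk n : u n < k by elim: n => //= n /nextP[].
have [|b bk ub] := small_bound (A := [set: nat]) (f := u) _ (fun n _ => uk n).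
  by rewrite card_ltNge; apply/negP.
have [|y yu ymin] := @wo_min _ _ hwo [set y | forall n, u n < y].
  by exists b => n; apply: ub.
exists y; last exact: (yu 0%N).
split; first by apply: le_lt_trans bk; apply: ymin => n; apply: ub.
move=> z zy; have [//|hzy] := leP (h z) y.
have [n zu] : exists n, z < u n.
  have [//|nou] := pselect (exists n, z < u n).
  suff : y <= z by rewrite leNgt zy.
  apply: ymin => n; apply: lt_le_trans (_ : u n.+1 <= z).
    by case: (nextP _ (uk n)).
  by rewrite leNgt; apply/negP => zu; apply: nou; exists n.+1.
have [_ _ /(_ _ zu) hz] := nextP _ (uk n).
by have := le_lt_trans hz (yu n.+1) => /(lt_trans hzy); rewrite ltxx.
Qed.

(** The points of [Y] cut the order into blocks, each point opening a new one, whence [z <= y]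
    rather than [z < y]. The rank is constant on blocks. *)
Definition separated (Y : set L) (x y : L) : Prop := exists z, [/\ Y z, x < z & z <= y].

Lemma separated_lt Y x y : separated Y x y -> x < y.
Proof. by move=> [z [_ /lt_le_trans]]; apply. Qed.

Lemma rank_mono Y p : is_rank (separated Y) p -> {homo p : x y / x <= y}.
Proof.
move=> pP x y xy; apply: (pP x).2 => w [z [Yz wz zx]]; apply: (pP y).1.
by exists z; split=> //; apply: le_trans xy.
Qed.

(** By induction each [z < x] is exceeded by a rank attained below [k]; a common bound [t] of the
    arguments then has rank at least [x]. *)
Lemma rank_unbounded Y p : is_rank (separated Y) p ->
  (forall x, x < k -> exists2 y, Y y /\ y < k & x < y) ->
  forall x, x < k -> exists2 t, t < k & x <= p t.
Proof.
move=> pP Yunb; elim/(well_founded_ind wo_wf) => x IH xk.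
have ex_y z : exists y, z < x -> y < k /\ z < p y.
  have [zx|] := boolP (z < x); last by exists k.
  have [t tk zt] := IH _ zx (lt_trans zx xk).
  have [y [Yy yk] ty] := Yunb _ tk.
  exists y => _; split=> //; apply: le_lt_trans zt _.
  by apply: (pP y).1; exists y.
have [y yP] := choice ex_y.
have [|t tk tP] := small_bound (f := y) (seg_small xk); first by move=> z /yP[].
exists t => //; rewrite leNgt; apply/negP => ptx.
have [_] := yP _ ptx.
by move=> /lt_le_trans /(_ (rank_mono pP (ltW (tP _ ptx)))); rewrite ltxx.
Qed.

(* A least point [x] of [S] of rank at least [v] has rank [v]: were some [w] of
   rank at least [v] separated from [x], then [S] would meet the interval between
   [w] and the separating point, below [x]. *)
Lemma rank_attained Y p (S : set L) v t : is_rank (separated Y) p ->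
  (forall x, x < k -> exists2 s, S s & x <= s) ->
  (forall x y, x < y -> y < k -> Y y -> exists s, [/\ S s, x <= s & s < y]) ->
  S `<=` seg k -> t < k -> v < p t -> exists s, [/\ S s, s < t & p s = v].
Proof.
move=> pP Sunb Shit Sk tk vt.
have [|s [Ss vs] smin] := @wo_min _ _ hwo [set s | S s /\ v <= p s].
  have [s Ss ts] := Sunb _ tk; exists s; split=> //.
  exact: le_trans (ltW vt) (rank_mono pP ts).
have psv : p s = v.
  apply/le_anti; rewrite vs andbT; apply: (pP s).2 => w [z [Yz wz zs]].
  rewrite ltNge; apply/negP => vw.
  have [s' [Ss' ws' s'z]] := Shit w z wz (le_lt_trans zs (Sk _ Ss)) Yz.
  have := smin s' (conj Ss' (le_trans vw (rank_mono pP ws'))).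
  by rewrite leNgt (lt_le_trans s'z zs).
exists s; split=> //; rewrite ltNge; apply/negP => ts.
by have := lt_le_trans vt (rank_mono pP ts); rewrite psv ltxx.
Qed.

(** * Cofinal families and the assignment of small sets to functions *)

Lemma Ikl_pos_cofinal (B : set (set L)) a : Ikl_pos k B -> Pkl k a ->
  exists2 b, B b & a `<=` b.
Proof.
move=> [BP nB] aP; have [//|nob] := pselect (exists2 b, B b & a `<=` b).
exfalso; apply: nB; split=> //; exists a => //.
by apply/seteqP; split=> // b [Bb [_ ab]]; apply: nob; exists b.
Qed.

Lemma ounion_max (a : set L) b : a `<=` seg k -> a #< seg k -> a b ->
  (forall x, a x -> x <= b) -> ounion k a = b.
Proof.
move=> ak asm ab amax; have [segE _] := ounionP hwo hreg ak asm.
have {}segE : seg (ounion k a) = seg b.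
  rewrite segE; apply/seteqP; split=> [z [x ax zx]|z zb]; last by exists b.
  exact: lt_le_trans zx (amax _ ax).
apply/le_anti/andP; split; rewrite leNgt; apply/negP => h.
  by have : seg (ounion k a) b by []; rewrite segE /seg/= ltxx.
by have : seg b (ounion k a) by []; rewrite -segE /seg/= ltxx.
Qed.

(** Both alternatives of the hypothesis are unified: singletons serve when [X] is smaller than [L],
    and the members of the family [T] otherwise. *)
Lemma dominating_assignment (U : Type) (X : set U) :
  X #< [set: L] \/ calK k X ->
  exists psi : U -> set L, (forall f, X f -> Pkl k (psi f)) /\
    forall a, Pkl k a -> [set f | X f /\ psi f `<=` a] #< seg k.
Proof.
case=> [/andP[XL _]|[_ [T [TP TX Tk]]]].
  have [i _ iinj] := card_leE k XL.
  exists (fun f => [set i f]); split=> [f _|a [_ ask]].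
    by split=> //; apply: small_set1.
  apply: card_le_lt_trans ask; apply: (card_leI (f := i)) => [f [_]|f g].
    by apply.
  by rewrite !inE => -[Xf _] [Xg _]; apply: iinj; rewrite inE.
have [psi psiT psiinj] : exists2 psi, forall f, X f -> T (psi f) & {in X &, injective psi}.
  by apply: (card_leE set0); move: TX; rewrite card_eq_sym card_eq_le => /andP[].
exists psi; split=> [f Xf|a aP]; first exact/TP/psiT.
apply: card_le_lt_trans (Tk _ aP); apply: (card_leI (f := psi)) => [f [Xf fa]|f g].
  by split=> //; apply: psiT.
by rewrite !inE => -[Xf _] [Xg _]; apply: psiinj; rewrite inE.
Qed.

End Regular.
End WellOrder.

(** * The colouring by ranks and the failure of the partition relation *)

Theorem theorem15p2 (d : Order.disp_t) (lambda : orderType d)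
    (hwo : wellordered lambda) (hlambda : top_is_cardinal lambda)
    (kappa : lambda)
    (hreg : regular_cardinal kappa) (hunc : ~ countable (seg kappa))
    (ha : limit_cardinal kappa /\ pow_below_eq kappa kappa)
    (hb : dbar kappa #< [set: lambda] \/ calK kappa (dbar kappa)) :
  ~ square_bracket kappa kappa.
Proof.
have [psi [psiP psi_small]] := dominating_assignment hreg hb.
have [domX _] := dbarP hwo hreg; set X := dbar kappa in domX psiP psi_small.
have [_ [_ hpow _]] := ha.
have [e eP] := bounded_subset_codes hwo hreg hpow.
(* Fewer than [kappa] functions [f] have [psi f] inside [a], so regularity bounds them strictly at
   each point. *)
have ex_H (a : set lambda) : exists h : lambda -> lambda, Pkl kappa a ->
    (forall x, x < kappa -> h x < kappa) /\
    forall f, X f -> psi f `<=` a ->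
    forall x : seg kappa, \val (f x) < h (\val x).
  have [aP|] := pselect (Pkl kappa a); last by exists id.
  have ex_b x : exists b, x < kappa -> b < kappa /\
      forall f, X f -> psi f `<=` a ->
      forall x' : seg kappa, \val x' = x -> \val (f x') < b.
    have [xk|] := boolP (x < kappa); last by exists kappa.
    have xk' : x \in seg kappa by rewrite inE.
    have [|b bk bP] := small_bound hreg (f := fun f => \val (f (SigSub xk')))
      (psi_small _ aP).
      by move=> f _; have := valP (f (SigSub xk')); rewrite inE.
    exists b => _; split=> // f Xf fa x' x'E.
    have -> : x' = SigSub xk' by apply: val_inj.
    exact: bP.
  have [h hP] := choice ex_b.
  exists h => _; split=> [x /hP[]//|f Xf fa x].
  have xk : \val x < kappa by have := valP x; rewrite inE.
  exact: (hP _ xk).2.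
have [H HP] := choice ex_H.
pose C a := closure_points kappa (H a).
have ex_rank (Y : set lambda) : exists p, is_rank (separated Y) p /\ forall x, p x <= x.
  by have [p pP px] := rank_exists hwo (@separated_lt _ _ Y); exists p.
have [p /all_and2[pP px]] := choice ex_rank.
pose code a b t := forall y, y <= t -> (e b y <-> C a y).
have p_code a b t x : code a b t -> x <= t -> p (e b) x = p (C a) x.
  move=> abt; apply: (rank_local hwo (@separated_lt _ _ (e b)) (pP _) (pP _)).
  by move=> y z zt; split=> -[w [Yw yw wz]]; exists w; split=> //;
    apply/abt => //; apply: le_trans zt.
(* Here m is the largest member of b below kappa. It codes the closure points
   belonging to b \ {m} on an initial segment [0, t] that is long enough for the
   rank to exceed every other member of b below kappa. *)
pose A : set (set lambda) := [set b | Pkl kappa b /\ exists m t,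
  [/\ b m, m < kappa, (forall x, b x -> x < kappa -> x <= m) &
  [/\ t < m, (forall x, b x -> x < m -> x <= p (C (b `\ m)) t) & code (b `\ m) m t]]].
have small_k b : Pkl kappa b -> b `&` seg kappa #< seg kappa.
  by move=> [_ bs]; apply: card_le_lt_trans bs; apply: subset_card_le => x [].
have AP b : A b -> exists m t,
    [/\ ounion kappa (b `&` seg kappa) = m, b m, m < kappa,
        (forall x, b x -> x < kappa -> x <= m) &
    [/\ t < m, (forall x, b x -> x < m -> x <= p (C (b `\ m)) t) &
        code (b `\ m) m t]].
  move=> [bP [m [t [bm mk bmax tP]]]]; exists m, t; split=> //.
  apply: (ounion_max hwo hreg) => //; first exact: small_k.
  by move=> x [bx xk]; apply: bmax.
have Apos : Ikl_pos kappa A.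
  split=> [b []//|[_ [a aP aA]]].
  have [|x xk xP] := small_bound hreg (f := id) (small_k _ aP); first by move=> x [].
  have [Hk _] := HP _ aP.
  have [t tk xt] : exists2 t, t < kappa & x <= p (C a) t.
    apply: (rank_unbounded hwo hreg (pP _)) => // y yk.
    have [z Cz yz] := closure_points_unbounded hwo hreg hunc Hk yk.
    by exists z => //; split=> //; case: Cz.
  (* A code above [x] is outside [a] and is the largest member of [a] with [m] added below [kappa],
     so removing it gives back [a]. *)
  have mk : Order.max x t < kappa by rewrite gt_max xk tk.
  have [m [m_k xtm cd]] := eP (C a) _ _ mk tk.
  move: xtm; rewrite gt_max => /andP[xm tm].
  have am : ~ a m by move=> am; have := lt_trans xm (xP m (conj am m_k)); rewrite ltxx.
  have amE : (a `|` [set m]) `\ m = a.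
    apply/seteqP; split=> [y [[]//]|y ay]; split; first by left.
    by move=> ym; apply: am; rewrite -ym.
  have bP : Pkl kappa (a `|` [set m]).
    split=> //; apply: (small_setU hreg); first by case: aP.
    exact: small_set1.
  suff : @set0 (set lambda) (a `|` [set m]) by [].
  rewrite -aA.
  split; last by split=> // y ay; left.
  split=> //; exists m, t; rewrite /code amE; split=> //; first by right.
    by move=> y [ay|->] yk //; apply: ltW (lt_trans (xP y _) xm).
  split=> // y [ay|->]; last by rewrite ltxx.
  by move=> ym; apply: le_trans xt; apply/ltW/xP; split=> //; apply: lt_trans m_k.
pose F (q : lambda * lambda) := p (e q.2) q.1.
move=> /(_ F) sqF; have [|B [Bpos BA FB]] := sqF _ A Apos.
  move=> q [a [b [aP bP qE _]]]; rewrite /seg/= /F.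
  apply: le_lt_trans (px _ _) _; rewrite qE /=.
  apply: (ounionP hwo hreg _ (small_k _ aP)).2.
  by move=> x [].
apply: FB.
pose S : set lambda := [set ounion kappa (b `&` seg kappa) | b in B].
have Sk : S `<=` seg kappa.
  by move=> _ [b /BA /AP[m [t [E _ mk _ _]]] <-]; rewrite E.
have Sunb x : x < kappa -> exists2 s, S s & x <= s.
  move=> xk; have [|b Bb xb] := Ikl_pos_cofinal Bpos (a := [set x]).
    by split=> //; apply: small_set1.
  exists (ounion kappa (b `&` seg kappa)); first by exists b.
  have [m [t [-> _ _ bmax _]]] := AP _ (BA _ Bb).
  by apply: bmax => //; apply: xb.
(* [g] jumps to a point of [S] at or above its argument; dominating it will control the gaps of
   [S]. *)
have ex_g (x : seg kappa) : exists s : seg kappa, S (\val s) /\ \val x <= \val s.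
  have xk : \val x < kappa by have := valP x; rewrite inE.
  have [s Ss xs] := Sunb _ xk.
  have sk : s \in seg kappa by rewrite inE; apply: Sk.
  by exists (SigSub sk).
have [g gP] := choice ex_g.
have [x [xX xs] gx] := domX g.
apply/seteqP; split=> [_ [q [a [b [Ba Bb qE _]]] <-]|v vk].
  rewrite /seg/= /F; apply: le_lt_trans (px _ _) _; rewrite qE /=.
  by apply: Sk; exists a.
(* If a small set contains [a1], its function [H] exceeds [g] everywhere. *)
pose a1 := \bigcup_(f in x) psi f.
have a1P : Pkl kappa a1.
  split=> //; apply: (small_bigcup hreg) => // f xf.
  by case: (psiP f) => //; apply: xX.
have [|u uk a1u] := small_bound hreg (f := id) (small_k _ a1P); first by move=> y [].
(* Putting [z] into [b] forces [w < m]. Then [w], a member of [b] below [m], makes the rank of [t]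
   exceed [v], and [u < w] keeps [m] out of [a1]. *)
have wk : Order.max u v < kappa by rewrite gt_max uk vk.
have [w {}wk] := lt_limit hreg wk; rewrite gt_max => /andP[uw vw].
have [z zk wz] := lt_limit hreg wk.
have [|b Bb ab] := Ikl_pos_cofinal Bpos (a := a1 `|` [set w; z]).
  split=> //; apply: (small_setU hreg); first by case: a1P.
  by apply: (small_finite hreg); apply: finite_set2.
have [m [t [bE bm mk bmax [tm pt cd]]]] := AP _ (BA _ Bb).
have zm : z <= m by apply: bmax => //; apply: ab; right; right.
have wm := lt_le_trans wz zm.
have a1b : a1 `<=` b `\ m.
  move=> y a1y; split; first by apply: ab; left.
  move=> ym; have := a1u y; rewrite ym => /(_ (conj _ mk)) mu.
  by have := lt_trans uw wm; rewrite ltNge => /negP[]; apply/ltW/mu; rewrite -ym.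
have bmP : Pkl kappa (b `\ m).
  split=> //; have [[_ bs] _] := BA _ Bb.
  by apply: card_le_lt_trans bs; apply: subset_card_le => y [].
have [_ Hdom] := HP _ bmP.
have vt : v < p (C (b `\ m)) t.
  by apply: lt_le_trans vw _; apply: pt => //; apply: ab; right; left.
have [|s [Ss st ps]] := rank_attained hwo (pP (C (b `\ m))) Sunb _ Sk
  (lt_trans tm mk) vt.
  (* For a closure point [c] above [y], the chain [y <= g y < f y < H y <= c] puts a point of [S] in
     the interval from [y] to [c]. *)
  move=> y c yc ck [_ Cc].
  have yk : y \in seg kappa by rewrite inE; apply: lt_trans ck.
  have [Sg yg] := gP (SigSub yk); exists (\val (g (SigSub yk))); split=> //.
  have [f xf /= gf] := gx (SigSub yk).
  have fH := Hdom f (xX _ xf) (fun y' fy' => a1b _ (ex_intro2 _ _ f xf fy')) (SigSub yk).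
  exact: lt_le_trans (lt_trans gf fH) (Cc _ yc).
(* Since [s < t], the set coded by [m] gives [s] its true rank [v]. *)
exists (s, m); last by rewrite /F /= (p_code _ _ _ _ cd) // ltW.
have [a Ba aE] := Ss.
by exists a, b; split=> //=; [rewrite aE bE|apply: lt_trans tm].
Qed.
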